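(* Let $G$ be a connected $k$-regular simple graph with $v$ vertices ($v$ finite), and let $\tau_0=k,\tau_1,\ldots,\tau_d$ be the distinct eigenvalues of $G$. Suppose there exists a real polynomial $f(x)=\sum_{i\ge 0} f_i F_i^{(k)}(x)$ (a finite sum, with real coefficients $f_i$) such that $f(k)>0$, $f(\tau_i)\le 0$ for every $i\in\{1,\ldots,d\}$, $f_0>0$, and $f_i\ge 0$ for every $i\ge 1$. Then \[ v\le \frac{f(k)}{f_0}. \]
   Context: The eigenvalues of a finite graph are the eigenvalues of its adjacency matrix. For given $k$, the polynomials $F_i^{(k)}(x)$, with $\deg F_i^{(k)}=i$, are defined by \[ F_0^{(k)}(x)=1,\qquad F_1^{(k)}(x)=x,\qquad F_2^{(k)}(x)=x^2-k, \] and $F_i^{(k)}(x)=xF_{i-1}^{(k)}(x)-(k-1)F_{i-2}^{(k)}(x)$ for $i\ge 3$. *)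

(* Defs.v *)
(* MathComp; the reals are an arbitrary [R : realType]. *)
From HB Require Import structures.
From mathcomp Require Import all_boot all_order all_algebra.
From mathcomp Require Import reals.

Set Implicit Arguments.
Unset Strict Implicit.
Unset Printing Implicit Defensive.

Import Order.TTheory GRing.Theory Num.Theory.
Local Open Scope ring_scope.

(* A simple graph on the vertex set [T] is given by its adjacency relation. *)
Definition simple_graph (T : finType) (e : rel T) : Prop :=
  symmetric e /\ irreflexive e.

Definition connected_graph (T : finType) (e : rel T) : Prop :=
  (0 < #|T|)%N /\ forall x y : T, connect e x y.

Definition regular_graph (T : finType) (e : rel T) (k : nat) : Prop :=
  forall x : T, #|[set y | e x y]| = k.

Definition adjacency_mx (R : realType) (T : finType) (e : rel T) : 'M[R]_#|T| :=
  \matrix_(i, j) (e (enum_val i) (enum_val j))%:R.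

(* F_i^(k). The case i = 2 is not an instance of the recurrence, which would
   give X^2 - (k - 1); and [k%:R - 1] is subtracted in [R], so it is -1 for
   k = 0. *)
Fixpoint Fpoly (R : realType) (k i : nat) : {poly R} :=
  match i with
  | 0 => 1
  | 1 => 'X
  | 2 => 'X^2 - k%:R%:P
  | ((_.+1 as i2).+1 as i1).+1 => 'X * Fpoly R k i1 - (k%:R - 1) *: Fpoly R k i2
  end.

(* Main.v *)
Require Import Defs.
From HB Require Import structures.
From mathcomp Require Import all_boot all_order all_algebra.
From mathcomp Require Import reals.
From mathcomp Require Import complex.
From mathcomp Require Import ring.

Set Implicit Arguments.
Unset Strict Implicit.
Unset Printing Implicit Defensive.

Import Order.TTheory GRing.Theory Num.Theory.
Local Open Scope ring_scope.

(** Diagonalize the adjacency matrix A as P A = D P over the reals.  For a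
    k-regular graph, F_i^(k)(A) is the matrix whose (x, y) entry is the number
    of walks of length i from x to y that never step back along the edge they
    have just crossed ([nbwalk]): extending such a walk by any edge gives either
    a non-backtracking walk or a walk that has just stepped back, and the latter
    are counted by the second term of the recurrence ([nbwalk_rec]).  Here f(A)
    is never formed as a polynomial in A: the matrix [walk_mx] of the weighted
    numbers of walks, sum_i f_i nbwalk_i, acts on each eigenvector of A as the
    scalar f(t) ([nbwalk_eigen]), so P conjugates it to f(D)
    ([walk_mx_diagonal]).

    The bound then comes from computing the trace of [walk_mx] in two ways.  As
    a sum of diagonal entries it is at least f_0 v, because numbers of walks and
    the f_i are nonnegative and there is exactly one walk of length 0 from a
    vertex to itself ([walk_mx_trace_ge]).  As the sum of f over the spectrum of
    A with multiplicities it is at most f(k), because f is nonpositive at every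
    eigenvalue except k, where f(k) > 0, and k is a simple eigenvalue of a
    connected graph ([degree_eigenvalue_simple]). *)

(** * Real symmetric matrices *)

(** The spectral theorem over R[i] gives a unitary P and a diagonal matrix with
    real entries.  Two real matrices that are similar over R[i] are similar over
    R, so P can be replaced by a real matrix, which is no longer claimed to be
    orthogonal. *)
Lemma symmetric_diagonalizable (R : rcfType) (n : nat) (A : 'M[R]_n) :
  A^T = A ->
  exists (P : 'M[R]_n) (d : 'rV[R]_n),
    P \in unitmx /\ P *m A = diag_mx d *m P.
Proof.
move=> A_sym; pose toC := real_complex R.
have real_map m p (B : 'M[R]_(m, p)) : map_mx toC B \is a mxOver Num.real.
  by apply/mxOverP => i j; rewrite mxE; apply/complex_realP; exists (B i j).
have real_lift m p (B : 'M[R[i]]_(m, p)) :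
    B \is a mxOver Num.real -> exists B', B = map_mx toC B'.
  move=> /mxOverP B_real; exists (map_mx (@complex.Re R) B).
  by apply/matrixP => i j; rewrite !mxE; apply/esym/RRe_real.
pose B := map_mx toC A.
have B_herm : B \is hermsymmx.
  apply: realsym_hermsym (real_map _ _ _).
  by apply/is_hermitianmxP; rewrite expr0 scale1r map_mx_id // map_trmx A_sym.
have D_real := hermitian_spectral_diag_real B_herm.
have /orthomx_spectralP B_eq := hermitian_normalmx B_herm.
have [d d_eq] := real_lift _ _ _ D_real.
move: B_eq (spectral_unit B); rewrite d_eq.
move: (spectralmx B) => U B_eq U_unit.
have B_sim : similar_in unitmx B (map_mx toC (diag_mx d)).
  exists U => //; apply/(similarP U_unit).
  by rewrite B_eq map_diag_mx -mulmxA mulKVmx.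
have [Q /andP[/= Q_real Q_unit]] :=
  real_similar B_sim (real_map _ _ _) (real_map _ _ _).
move/(similarP Q_unit) => QB.
have [P P_eq] := real_lift _ _ _ Q_real.
exists P, d; move: Q_unit QB; rewrite P_eq map_unitmx => P_unit' QB.
split=> //; apply: (map_mx_inj (f := toC)).
by rewrite !map_mxM -QB.
Qed.

(** * Non-backtracking walks *)

(** Number of non-backtracking walks of length [i.+1] that start at [x] and end
    with the arc from [z] to [y].  Remembering the last arc, not only the last
    vertex, is what lets the walk be extended without stepping back. *)
Fixpoint nbarc (T : finType) (e : rel T) (i : nat) (x z y : T) : nat :=
  if i is j.+1 then (e z y * \sum_(u | u != y) nbarc e j x u z)%N
  else (x == z) && e z y.

Definition nbwalk (T : finType) (e : rel T) (i : nat) (x y : T) : nat :=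
  if i is j.+1 then (\sum_z nbarc e j x z y)%N else x == y.

Section NonBacktrackingWalks.

Variables (T : finType) (e : rel T) (k : nat).
Hypotheses (e_sym : symmetric e) (e_reg : regular_graph e k).

Lemma degree_sum (x : T) : (\sum_y e x y)%N = k.
Proof.
rewrite -(e_reg x) -sum1_card -big_mkcondr /= [RHS]big_mkcond.
by rewrite [LHS]big_mkcond; apply: eq_bigr => y _; rewrite inE; case: (e x y).
Qed.

Lemma nbarc_edge (i : nat) (x z y : T) :
  nbarc e i x z y = (e z y * nbarc e i x z y)%N.
Proof. by case: i => [|i] /=; case: (e z y); rewrite ?andbF ?mul1n ?mul0n. Qed.

Lemma nbwalk1 (x y : T) : nbwalk e 1 x y = e x y.
Proof.
rewrite /= (bigD1 x) //= eqxx big1 ?addn0 // => z z_neq.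
by rewrite eq_sym (negbTE z_neq).
Qed.

(** A non-backtracking walk from [x] to [z] followed by an edge from [z] to [y]
    steps back exactly when its last arc goes from [y] to [z]. *)
Lemma nbwalk_extend (i : nat) (x y : T) :
  (nbwalk e i.+2 x y + \sum_z e z y * nbarc e i x y z)%N
  = (\sum_z nbwalk e i.+1 x z * e z y)%N.
Proof.
rewrite -big_split; apply: eq_bigr => z _ /=.
by rewrite -mulnDr mulnC [in RHS](bigD1 y) //= addnC.
Qed.

(** After a walk of length 1 the step back returns to [x], along any of the [k]
    edges at [x]: this is why F_2 subtracts k instead of k - 1. *)
Lemma nbwalk2 (x y : T) :
  (nbwalk e 2 x y + k * (x == y))%N = (\sum_z nbwalk e 1 x z * e z y)%N.
Proof.
rewrite -nbwalk_extend; congr addn.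
rewrite -(degree_sum y) big_distrl; apply: eq_bigr => z _ /=.
by rewrite [e z y]e_sym; case: (e y z); rewrite ?andbT ?andbF.
Qed.

(** A walk of length at least 3 that steps back only at the end is a
    non-backtracking walk to [y], followed by an edge to a neighbour of [y] other
    than the vertex before [y], and back: k - 1 choices.  Both sides carry an
    extra [nbwalk e i.+1 x y] so that no truncated subtraction k - 1 occurs; the
    identity then also holds for k = 0. *)
Lemma nbwalk_rec (i : nat) (x y : T) :
  (nbwalk e i.+3 x y + k * nbwalk e i.+1 x y)%N
  = (\sum_z nbwalk e i.+2 x z * e z y + nbwalk e i.+1 x y)%N.
Proof.
rewrite -nbwalk_extend -addnA; congr addn.
rewrite -(degree_sum y) big_distrl -big_split; apply: eq_bigr => z _ /=.
rewrite (nbarc_edge i x z y) [e z y]e_sym.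
by case: (e y z); rewrite ?mul0n // !mul1n [in LHS](bigD1 z) //= addnC.
Qed.

(** The matrix of numbers of non-backtracking walks of length [i] is F_i(A):
    on a left eigenvector of A it acts as the value of F_i at the eigenvalue. *)
Lemma nbwalk_eigen (R : realType) (t : R) (u : T -> R) :
  (forall y, \sum_x u x * (e x y)%:R = t * u y) ->
  forall (i : nat) (y : T),
    \sum_x u x * (nbwalk e i x y)%:R = (Fpoly R k i).[t] * u y.
Proof.
move=> u_eigen.
have extend i s y :
    (forall z, \sum_x u x * (nbwalk e i x z)%:R = s * u z) ->
    \sum_x u x * (\sum_z nbwalk e i x z * e z y)%:R = t * s * u y.
  move=> iF; rewrite mulrAC -u_eigen big_distrl /=.
  under eq_bigr => x _ do rewrite natr_sum big_distrr /=.
  rewrite exchange_big /=; apply: eq_bigr => z _.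
  rewrite mulrAC [u z * _]mulrC -iF big_distrl /=.
  by apply: eq_bigr => x _; rewrite natrM mulrA.
have walk0 y : \sum_x u x * (nbwalk e 0 x y)%:R = u y.
  rewrite (bigD1 y) //= eqxx mulr1 big1 ?addr0 // => x /negbTE->.
  by rewrite mulr0.
have walk1 y : \sum_x u x * (nbwalk e 1 x y)%:R = t * u y.
  by rewrite -u_eigen; apply: eq_bigr => x _; rewrite nbwalk1.
suff step i : (forall y, \sum_x u x * (nbwalk e i.+1 x y)%:R
                         = (Fpoly R k i.+1).[t] * u y) /\
              (forall y, \sum_x u x * (nbwalk e i.+2 x y)%:R
                         = (Fpoly R k i.+2).[t] * u y).
  by case=> [|i] y; [rewrite walk0 hornerE mul1r | case: (step i)].
elim: i => [|i [IH1 IH2]]; split=> // y.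
- by rewrite walk1 /= hornerX.
- have := extend _ _ y walk1.
  under eq_bigr => x _ do rewrite -nbwalk2 natrD natrM mulrDr mulrCA.
  rewrite big_split -mulr_sumr walk0 => rec.
  transitivity ((t * t - k%:R) * u y); last by rewrite !hornerE.
  by rewrite mulrBl -rec addrK.
- have := extend _ _ y IH2.
  under eq_bigr => x _.
    have /(congr1 (fun m => m%:R : R)) := nbwalk_rec i x y.
    rewrite !natrD natrM => /eqP; rewrite -subr_eq => /eqP <-.
    rewrite mulrBr mulrDr mulrCA.
    over.
  rewrite sumrB big_split /= -mulr_sumr !IH1 => rec.
  transitivity ((t * (Fpoly R k i.+2).[t]
                 - (k%:R - 1) * (Fpoly R k i.+1).[t]) * u y).
    by rewrite mulrBl -rec; ring.
  by rewrite !hornerE.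
Qed.

End NonBacktrackingWalks.

(** * The eigenvalue k *)

(** The Dirichlet energy, the sum of (v x - v y)^2 over the arcs, is twice the
    quadratic form of k - A at [v].  It vanishes on an eigenvector for k, which is
    therefore constant along edges and, by connectedness, everywhere. *)
Lemma eigenvector_degree_const (R : realDomainType) (T : finType) (e : rel T)
    (k : nat) (v : T -> R) :
  symmetric e -> (forall x y, connect e x y) -> regular_graph e k ->
  (forall y, \sum_x v x * (e x y)%:R = k%:R * v y) ->
  forall x y, v x = v y.
Proof.
move=> e_sym e_conn e_reg v_eigen.
have degree_sumR (x : T) : \sum_y (e x y)%:R = k%:R :> R.
  by rewrite -(degree_sum e_reg x) natr_sum.
pose energy := \sum_x \sum_y (e x y)%:R * (v x - v y) ^+ 2.
have energy0 : energy = 0.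
  have sqr_out : \sum_x \sum_y (e x y)%:R * v x ^+ 2 = k%:R * \sum_x v x ^+ 2.
    rewrite mulr_sumr; apply: eq_bigr => x _.
    by rewrite -mulr_suml degree_sumR.
  have sqr_in : \sum_x \sum_y (e x y)%:R * v y ^+ 2 = k%:R * \sum_x v x ^+ 2.
    rewrite exchange_big -sqr_out; apply: eq_bigr => x _.
    by apply: eq_bigr => y _; rewrite e_sym.
  have cross : \sum_x \sum_y v x * (e x y)%:R * v y = k%:R * \sum_x v x ^+ 2.
    rewrite exchange_big mulr_sumr; apply: eq_bigr => y _ /=.
    by rewrite -mulr_suml v_eigen expr2 mulrA.
  have -> : energy = \sum_x \sum_y (e x y)%:R * v x ^+ 2
                     + \sum_x \sum_y (e x y)%:R * v y ^+ 2
                     - (\sum_x \sum_y v x * (e x y)%:R * v y) *+ 2.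
    rewrite -sumrMnl -big_split -sumrB; apply: eq_bigr => x _ /=.
    rewrite -sumrMnl -big_split -sumrB; apply: eq_bigr => y _ /=.
    ring.
  by rewrite sqr_out sqr_in cross mulr2n subrr.
have term_ge0 x y : 0 <= (e x y)%:R * (v x - v y) ^+ 2.
  by rewrite mulr_ge0 ?ler0n ?sqr_ge0.
have edge_const x y : e x y -> v x = v y.
  move=> xy; move/eqP: energy0.
  rewrite psumr_eq0 => [|i _]; last exact: sumr_ge0.
  move/allP/(_ x (mem_index_enum _)); rewrite psumr_eq0 => [|j _] //.
  move/allP/(_ y (mem_index_enum _)).
  by rewrite /= xy mul1r sqrf_eq0 subr_eq0 => /eqP.
move=> x y.
have v_closed : closed e [pred z | v z == v x].
  by move=> a b ab; rewrite !inE (edge_const _ _ ab).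
have := closed_connect v_closed (e_conn x y).
by rewrite !inE eqxx => /esym/eqP.
Qed.

Lemma sum_enum_rank (V : nmodType) (T : finType) (F : 'I_#|T| -> V) :
  \sum_a F a = \sum_x F (enum_rank x).
Proof.
rewrite (reindex_onto enum_rank enum_val) => [|a _] /=; last exact: enum_valK.
by apply: eq_bigl => x; rewrite enum_rankK eqxx.
Qed.

Section DiagonalizedAdjacency.

Variables (R : realType) (T : finType) (e : rel T) (k : nat).
Hypotheses (e_sym : symmetric e) (e_reg : regular_graph e k).
Variables (P : 'M[R]_#|T|) (D : 'rV[R]_#|T|).
Hypotheses (P_unit : P \in unitmx).
Hypotheses (PA : P *m adjacency_mx R e = diag_mx D *m P).

Lemma adjacency_eigenrow (j : 'I_#|T|) (y : T) :
  \sum_x P j (enum_rank x) * (e x y)%:R = D 0 j * P j (enum_rank y).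
Proof.
have /matrixP/(_ j (enum_rank y)) := PA.
rewrite mul_diag_mx !mxE => <-; rewrite sum_enum_rank.
by apply: eq_bigr => x _; rewrite !mxE !enum_rankK.
Qed.

Lemma adjacency_eigenvalue (j : 'I_#|T|) :
  eigenvalue (adjacency_mx R e) (D 0 j).
Proof.
apply/eigenvalueP; exists (row j P).
  by rewrite -row_mul PA; apply/rowP => a; rewrite mul_diag_mx !mxE.
apply/eqP => Pj0; have /(congr1 (row j)) := mulmxV P_unit.
rewrite row_mul Pj0 mul0mx => /rowP/(_ j)/eqP.
by rewrite !mxE eqxx eq_sym oner_eq0.
Qed.

(** Rows of [P] for the eigenvalue k are constant, and two constant rows of an
    invertible matrix are the same row. *)
Lemma degree_eigenvalue_simple (j l : 'I_#|T|) :
  (forall x y, connect e x y) -> D 0 j = k%:R -> D 0 l = k%:R -> j = l.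
Proof.
move=> e_conn Dj Dl; pose s m := \sum_a invmx P a m.
(* For a constant row the identity P P^-1 = 1 says that its constant value times
   the m-th column sum s m of P^-1 is a Kronecker delta. *)
have row_s i m : D 0 i = k%:R -> P i j * s m = (i == m)%:R.
  move=> Di; have /matrixP/(_ i m) := mulmxV P_unit; rewrite !mxE => <-.
  rewrite mulr_sumr; apply: eq_bigr => a _; congr (_ * _).
  rewrite -[j in LHS]enum_valK -[a in RHS]enum_valK.
  apply: (eigenvector_degree_const (v := fun x => P i (enum_rank x))
            e_sym e_conn e_reg) => y.
  by rewrite adjacency_eigenrow Di.
apply/eqP; apply: contraT => jl.
have /eqP := row_s j l Dj; rewrite (negbTE jl) mulf_eq0 => /orP[] /eqP s0.
  by have /eqP := row_s j j Dj; rewrite s0 mul0r eqxx eq_sym oner_eq0.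
by have /eqP := row_s l l Dl; rewrite s0 mulr0 eqxx eq_sym oner_eq0.
Qed.

(** * The trace of f(A) *)

Variables (n : nat) (c : 'I_n.+1 -> R).

Definition walk_mx : 'M[R]_#|T| :=
  \matrix_(a, b) \sum_i c i * (nbwalk e i (enum_val a) (enum_val b))%:R.

Lemma walk_mx_trace_ge :
  (forall i, i != ord0 -> 0 <= c i) -> c ord0 * #|T|%:R <= \tr walk_mx.
Proof.
move=> c_ge0.
have -> : c ord0 * #|T|%:R = \sum_(a < #|T|) c ord0.
  by rewrite sumr_const card_ord mulr_natr.
apply: ler_sum => a _; rewrite mxE (bigD1 ord0) //= eqxx mulr1.
by rewrite lerDl sumr_ge0 // => i i_neq0; rewrite mulr_ge0 ?ler0n ?c_ge0.
Qed.

Let f := \sum_i c i *: Fpoly R k i.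

Lemma walk_mx_diagonal :
  P *m walk_mx = diag_mx (\row_j f.[D 0 j]) *m P.
Proof.
apply/matrixP => j b; rewrite mul_diag_mx !mxE sum_enum_rank.
under eq_bigr => x _ do rewrite mxE enum_rankK mulr_sumr.
rewrite exchange_big horner_sum mulr_suml; apply: eq_bigr => i _ /=.
rewrite hornerZ -mulrA -[P j b](congr1 (P j) (enum_valK b)).
rewrite -(nbwalk_eigen e_sym e_reg (adjacency_eigenrow j)) mulr_sumr.
by apply: eq_bigr => x _; rewrite mulrCA.
Qed.

Lemma walk_mx_trace : \tr walk_mx = \sum_j f.[D 0 j].
Proof.
rewrite -[walk_mx](mulKmx P_unit) walk_mx_diagonal mxtrace_mulC -mulmxA.
rewrite mulmxV // mulmx1 mxtrace_diag.
by apply: eq_bigr => j _; rewrite mxE.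
Qed.

End DiagonalizedAdjacency.

Theorem theorem2 (R : realType) (T : finType) (e : rel T) (k : nat)
    (d : nat) (tau : 'I_d.+1 -> R)
    (n : nat) (c : 'I_n.+1 -> R) (f : {poly R})
    (e_simple : simple_graph e)
    (e_connected : connected_graph e)
    (e_regular : regular_graph e k)
    (tau_inj : injective tau)
    (tau_eigen : forall a : R,
       eigenvalue (adjacency_mx R e) a <-> exists i, tau i = a)
    (tau0 : tau ord0 = k%:R)
    (fE : f = \sum_(i < n.+1) c i *: Fpoly R k i)
    (fk_gt0 : 0 < f.[k%:R])
    (ftau_le0 : forall i, i != ord0 -> f.[tau i] <= 0)
    (c0_gt0 : 0 < c ord0)
    (c_ge0 : forall i, i != ord0 -> 0 <= c i) :
  #|T|%:R <= f.[k%:R] / c ord0.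
Proof.
have [e_sym _] := e_simple; have [_ e_conn] := e_connected.
have adj_sym : (adjacency_mx R e)^T = adjacency_mx R e.
  by apply/matrixP => i j; rewrite !mxE e_sym.
have [P [D [P_unit PA]]] := symmetric_diagonalizable adj_sym.
have f_le0 j : D 0 j != k%:R -> f.[D 0 j] <= 0.
  have /tau_eigen[i <-] := adjacency_eigenvalue P_unit PA j.
  by move=> tau_i; apply/ftau_le0/(contraNneq _ tau_i) => ->; rewrite tau0.
have trace_le : \sum_j f.[D 0 j] <= f.[k%:R].
  case: (pickP (fun j => D 0 j == k%:R)) => [j /eqP Dj | no_k].
    rewrite (bigD1 j) //= Dj gerDl sumr_le0 // => l l_neq; apply: f_le0.
    apply: contraNneq l_neq => Dl.
    by rewrite (degree_eigenvalue_simple e_sym e_regular P_unit PA e_conn Dl Dj).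
  apply: le_trans (ltW fk_gt0); rewrite sumr_le0 // => j _.
  by apply: f_le0; rewrite no_k.
rewrite ler_pdivlMr // mulrC; apply: le_trans (walk_mx_trace_ge e c_ge0) _.
by rewrite (walk_mx_trace e_sym e_regular P_unit PA) -fE.
Qed.
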